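(* $P_6 + P_1$ is proportionally $(2,4)$-choosable.
   Context: All graphs are nonempty, finite and simple. $P_n$ denotes the path on $n$ vertices, and $G_1+G_2$ denotes the disjoint union of vertex-disjoint graphs $G_1$ and $G_2$. For $m\in\mathbb{N}=\{1,2,3,\ldots\}$, $[m]=\{1,\ldots,m\}$. For integers $1\le k\le \ell$, a $(k,\ell)$-assignment for a graph $G$ is a function $L$ assigning to each vertex $v$ of $G$ a set $L(v)\subseteq[\ell]$ with $|L(v)|=k$. Let $\mathcal{L}=\bigcup_{v\in V(G)}L(v)$ and, for $c\in\mathcal{L}$, let $\eta(c)=|\{v\in V(G): c\in L(v)\}|$. A proportional $L$-coloring of $G$ is a function $f$ on $V(G)$ with $f(v)\in L(v)$ for every $v$, with $f(u)\ne f(v)$ whenever $u,v$ are adjacent, and with $|f^{-1}(c)|\in\{\lfloor \eta(c)/k\rfloor,\lceil \eta(c)/k\rceil\}$ for every $c\in\mathcal{L}$. $G$ is proportionally $(k,\ell)$-choosable if a proportional $L$-coloring of $G$ exists for every $(k,\ell)$-assignment $L$ for $G$. *)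

(* Defs.v *)
From mathcomp Require Import all_boot.

Set Implicit Arguments.
Unset Strict Implicit.
Unset Printing Implicit Defensive.

Record sgraph := SGraph {
  vertex :> finType;
  adj : rel vertex;
  adj_sym : symmetric adj;
  adj_irr : irreflexive adj
}.

Section Path.
Variable n : nat.

Definition path_adj : rel 'I_n := fun i j => (i.+1 == j) || (j.+1 == i).

Lemma path_adj_sym : symmetric path_adj.
Proof. by move=> i j; rewrite /path_adj orbC. Qed.

Lemma path_adj_irr : irreflexive path_adj.
Proof. by move=> i; rewrite /path_adj orbb gtn_eqF. Qed.

Definition path_graph : sgraph := SGraph path_adj_sym path_adj_irr.
End Path.

Section DisjointUnion.
Variables G1 G2 : sgraph.

Definition union_adj : rel (G1 + G2)%type := fun x y =>
  match x, y with
  | inl u, inl v => adj u v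
  | inr u, inr v => adj u v
  | _, _ => false
  end.

Lemma union_adj_sym : symmetric union_adj.
Proof. by move=> [u|u] [v|v] //=; rewrite adj_sym. Qed.

Lemma union_adj_irr : irreflexive union_adj.
Proof. by move=> [u|u] /=; rewrite adj_irr. Qed.

Definition disjoint_union : sgraph := SGraph union_adj_sym union_adj_irr.
End DisjointUnion.

(* The color set {1, ..., l} is represented by 'I_l = {0, ..., l - 1}: the
   color c is the ordinal of value c - 1.  The notions below are meant for
   1 <= k <= l. *)
Section ProportionalColoring.
Variables (G : sgraph) (k l : nat).
Implicit Types (L : G -> {set 'I_l}) (f : G -> 'I_l) (c : 'I_l).

Definition is_assignment L : Prop := forall v, #|L v| = k.

Definition palette L : {set 'I_l} := \bigcup_(v : G) L v.

Definition multiplicity L c : nat := #|[set v : G | c \in L v]|.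

Definition ceil_div (m d : nat) : nat := (m %/ d) + ~~ (d %| m).

Definition proportional_coloring L f : Prop :=
  [/\ forall v, f v \in L v,
      forall u v, adj u v -> f u <> f v
    & forall c, c \in palette L ->
        #|[set v : G | f v == c]| = multiplicity L c %/ k \/
        #|[set v : G | f v == c]| = ceil_div (multiplicity L c) k].

Definition proportionally_choosable : Prop :=
  forall L, is_assignment L -> exists f, proportional_coloring L f.
End ProportionalColoring.

(* Main.v *)
Require Import Defs.
From mathcomp Require Import all_boot.
From mathcomp Require Import zify.

Set Implicit Arguments.
Unset Strict Implicit.
Unset Printing Implicit Defensive.

(** For lists of size 2, a color class has one of the two prescribed sizes iff
    the color is chosen and rejected equally often, up to one.  The six vertices
    of the path are colored one after the other, the isolated vertex last,
    and for every assignment we maintain a set of reachable states: the last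
    color used, and for every color the difference between the numbers of times
    it was chosen and rejected.  Only differences in [-2, 2] need to be kept;
    the remaining search over the 6^7 assignments is done by computation. *)

Definition pairs : seq (nat * nat) :=
  [seq p <- [seq (a, b) | a <- iota 0 4, b <- iota 0 4] | p.1 < p.2].

Definition in_pair (p : nat * nat) : pred nat := fun c => (c == p.1) || (c == p.2).

(* A difference [x] is stored as the natural number [x + 2]; in [shift q d] the
   color [q.1] is chosen and [q.2] rejected. *)
Definition shift (q : nat * nat) (d : seq nat) : seq nat :=
  incr_nth (set_nth 0 d q.2 (nth 0 d q.2).-1) q.1.

(** The guards keep the differences within [-2, 2]; the first one also keeps the truncated
    predecessor in [shift] exact. *)
Definition step (p : nat * nat) (d : seq nat) : seq (nat * seq nat) :=
  [seq (q.1, shift q d) | q <- [:: p; (p.2, p.1)]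
                        & (0 < nth 0 d q.2) && (nth 0 d q.1 < 4)].

Definition extend (p : nat * nat) (S : seq (nat * seq nat)) :=
  flatten [seq [seq x <- step p t.2 | x.1 != t.1] | t <- S].

(** Stored values 1, 2, 3 stand for the differences -1, 0, 1. *)
Definition balanced (d : seq nat) : bool :=
  all (fun c => 0 < nth 0 d c < 4) (iota 0 4).

(** The last vertex is isolated, so its color is not compared with the previous one as in
    [extend]. *)
Definition completable (S : seq (nat * seq nat)) : bool :=
  all (fun p => has (fun t => has (fun x => balanced x.2) (step p t.2)) S) pairs.

Fixpoint search n (S : seq (nat * seq nat)) : bool :=
  if n is n'.+1 then all (fun p => search n' (extend p S)) pairs
  else completable S.

(* 4 is not a color, so the first vertex of the path is unconstrained. *)
Lemma search_path6 : search 6 [:: (4, nseq 4 2)].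
Proof. by vm_compute. Qed.

(** A color chosen n times from m lists has difference n - (m - n) = 2n - m; the equation avoids
    subtraction. *)
Definition tracks (ps : seq (nat * nat)) (s d : seq nat) : Prop :=
  all2 (fun c p => in_pair p c) s ps /\
  forall c, c < 4 ->
    nth 0 d c + count (in_pair^~ c) ps = 2 + 2 * count_mem c s.

Definition reached (ps : seq (nat * nat)) (t : nat * seq nat) : Prop :=
  exists s, [/\ tracks ps s t.2, sorted (fun c e => c != e) s & t.1 = head 4 s].

Lemma tracks_step p ps s d x : p \in pairs -> tracks ps s d ->
  x \in step p d -> tracks (p :: ps) (x.1 :: s) x.2.
Proof.
rewrite mem_filter => /andP[lt_p _] [ps_s d_s] /mapP[q].
rewrite mem_filter => /andP[/andP[d_gt0 _] q_p] ->.
have [qp1 eq_p] : in_pair p q.1 /\ in_pair p =1 in_pair q.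
  by move: q_p; rewrite !inE /in_pair => /orP[] /eqP-> /=;
     rewrite eqxx ?orbT; split=> // c; rewrite /= orbC.
have q_neq : q.1 != q.2.
  by move: q_p; rewrite !inE => /orP[] /eqP-> /=; lia.
split=> [|c lt_c4] /=; first by rewrite qp1.
have := d_s c lt_c4; rewrite eq_p nth_incr_nth nth_set_nth /= [in_pair q c]/in_pair.
move: (count _ ps) (count_mem c s) => m n.
(* The cases: [c] is rejected, chosen, or outside the pair. *)
by move: q_neq d_gt0; case: (c =P q.2) => [->|_]; rewrite eq_sym; case: eqP => //= _; lia.
Qed.

(** Lists are read from the front of [qs], but [ps] has the latest vertex first; hence [catrev]. *)
Lemma searchP n S ps : search n S -> (forall t, t \in S -> reached ps t) ->
  forall qs, size qs = n -> all [in pairs] qs ->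
  exists2 S', completable S' & forall t, t \in S' -> reached (catrev qs ps) t.
Proof.
elim: n S ps => [|n IHn] S ps.
  by move=> S_ok S_ps [] // _ _; exists S.
move=> /(@allP _ _ pairs) S_ok S_ps [//|p qs] [size_qs] /= /andP[p_ok qs_ok].
apply: IHn (S_ok p p_ok) _ _ size_qs qs_ok => x /flatten_mapP[t t_S].
rewrite mem_filter => /andP[x_neq x_t].
have [s [s_t s_sorted s_head]] := S_ps t t_S.
exists (x.1 :: s); split=> //; first exact: tracks_step s_t x_t.
by move: x_neq; rewrite s_head; case: (s) s_sorted => //= e s' -> ->.
Qed.

Lemma balanced_coloring p ps : p \in pairs -> size ps = 6 -> all [in pairs] ps ->
  exists c s, [/\ all2 (fun c p => in_pair p c) (c :: s) (p :: ps),
    sorted (fun c e => c != e) s &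
    forall a, a < 4 ->
      let m := count (in_pair^~ a) (p :: ps) in
      let n := count_mem a (c :: s) in m <= n.*2.+1 /\ n.*2 <= m.+1].
Proof.
move=> p_ok size_ps ps_ok.
have init t : t \in [:: (4, nseq 4 2)] -> reached [::] t.
  rewrite inE => /eqP->; exists [::]; split=> //; split=> // c.
  by case: c => [|[|[|[|]]]].
(* Feeding the search [rev ps] makes the accumulated lists come out as [ps]. *)
have size_rev_ps : size (rev ps) = 6 by rewrite size_rev.
have rev_ps_ok : all [in pairs] (rev ps) by rewrite all_rev.
have [S /allP/(_ p p_ok)/hasP[t t_S /hasP[x x_t x_bal]]] :=
  searchP search_path6 init size_rev_ps rev_ps_ok.
rewrite catrevE revK cats0 => /(_ t t_S)[s [s_t s_sorted _]].
have [x_ps x_s] := tracks_step p_ok s_t x_t.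
exists x.1, s; split=> // a lt_a4 m n.
have := x_s a lt_a4; have /allP/(_ a) := x_bal.
by rewrite mem_iota => /(_ lt_a4); rewrite -/m -/n; move: m n (nth 0 x.2 a); lia.
Qed.

Lemma pair_of_set (A : {set 'I_4}) : #|A| = 2 ->
  exists2 p, p \in pairs & forall c : 'I_4, (c \in A) = in_pair p c.
Proof.
move/eqP/cards2P => [a [b [+ ->]]].
wlog lt_ab : a b / a < b => [wlog_ab neq_ab|_].
  have [/wlog_ab|lt_ba|/val_inj eq_ab] := ltngtP a b; first exact.
    by rewrite setUC; apply: wlog_ab; rewrite // eq_sym.
  by rewrite eq_ab eqxx in neq_ab.
exists (val a, val b) => [|c]; last by rewrite !inE.
by rewrite mem_filter lt_ab; apply/allpairsP; exists (val a, val b);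
   rewrite !mem_iota !ltn_ord.
Qed.

(** The isolated vertex comes first, to match [c :: s] and [p :: ps] in [balanced_coloring]. *)
Lemma card_path_add_point (Q : pred ('I_6 + 'I_1)) :
  #|[set v | Q v]| = count Q (inr ord0 :: [seq inl i | i <- enum 'I_6]).
Proof.
rewrite cardsE cardE -size_filter; apply/perm_size/uniq_perm.
- exact: enum_uniq.
- apply: filter_uniq; rewrite /= map_inj_uniq ?enum_uniq ?andbT; last by move=> i j [].
  by apply/mapP => -[].
move=> [i|i]; rewrite mem_enum mem_filter inE /= ?(ord1 i) ?inE ?eqxx ?andbT //.
by rewrite mem_map ?mem_enum ?andbT // => ? ? [].
Qed.

(** From |2n - m| <= 1, an even m forces n = m/2, and an odd m leaves the two roundings of m/2. *)
Lemma half_or_ceil_div m n : m <= n.*2.+1 -> n.*2 <= m.+1 ->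
  n = m %/ 2 \/ n = ceil_div m 2.
Proof. by rewrite /ceil_div; case: (boolP (2 %| m)); lia. Qed.

Theorem proposition16 :
  proportionally_choosable (disjoint_union (path_graph 6) (path_graph 1)) 2 4.
Proof.
move=> L L2.
have [P P_ok L_P] := fin_all_exists2 (fun v => pair_of_set (L2 v)).
set ps := [seq P (inl i) | i <- enum 'I_6].
have size_ps : size ps = 6 by rewrite size_map size_enum_ord.
have ps_ok : all [in pairs] ps by apply/allP => _ /mapP[i _ ->].
have [c [s [/= /andP[c_P s_ps] s_sorted s_bal]]] :=
  balanced_coloring (P_ok (inr ord0)) size_ps ps_ok.
have [size_s s_P] : size s = 6 /\ forall i : 'I_6, in_pair (P (inl i)) (nth 0 s i).
  move: s_ps; rewrite all2E size_ps => /andP[/eqP size_s /allP s_ps].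
  split=> // i.
  have /s_ps : nth (0, (0, 0)) (zip s ps) i \in zip s ps.
    by rewrite mem_nth // size_zip size_s size_ps minnn.
  by rewrite nth_zip ?size_s ?size_ps //= (nth_map i) ?size_enum_ord // nth_ord_enum.
have lt4 v a : in_pair (P v) a -> a < 4.
  move: (P_ok v); rewrite mem_filter => /andP[_ /allpairsP[q [+ + ->]]].
  by rewrite !mem_iota /in_pair /= => ? ? /orP[] /eqP->.
pose f (v : 'I_6 + 'I_1) : 'I_4 := inord (if v is inl i then nth 0 s i else c).
have f_l i : f (inl i) = nth 0 s i :> nat by rewrite inordK // (lt4 _ _ (s_P i)).
have f_r i : f (inr i) = c :> nat by rewrite inordK // (lt4 _ _ c_P).
have f_path (i j : 'I_6) : i.+1 = j -> f (inl i) <> f (inl j).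
  move=> ij /(congr1 val) /=; rewrite f_l f_l -ij; apply/eqP.
  by move/(sortedP 0): s_sorted; apply; rewrite size_s ij.
exists f; split.
- move=> [i|i]; rewrite L_P ?f_l ?f_r // (ord1 i); exact: c_P.
- move=> [i|i] [j|j] //=; last by rewrite !ord1.
  by rewrite /path_adj => /orP[] /eqP /f_path // ne /esym.
move=> a _; have [] := s_bal a (ltn_ord a).
have -> : (c == a) + count_mem (a : nat) s = #|[set v | f v == a]|.
  rewrite card_path_add_point /= -val_eqE /= f_r count_map; congr (_ + _).
  (* Writing [s] as the image of [enum 'I_6] under [nth 0 s] makes both sides count over path
     vertices. *)
  rewrite -[s](mkseq_nth 0) size_s /mkseq -val_enum_ord !count_map.
  by apply: eq_count => i /=; rewrite -(inj_eq val_inj) /= f_l.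
have -> : in_pair (P (inr ord0)) a + count (in_pair^~ (a : nat)) ps = multiplicity L a.
  rewrite /multiplicity card_path_add_point /= L_P !count_map; congr (_ + _).
  by apply: eq_count => i /=; rewrite L_P.
exact: half_or_ceil_div.
Qed.
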